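(* Let $\varepsilon=-\tfrac{1}{15}$ and consider the planar piecewise smooth system $$\dot x = 1-x-k(y)\,x,\qquad \dot y=\beta-\beta\varepsilon-k(y)\,\varepsilon-\alpha-(\beta+k(y))\,y-(\alpha\beta-\alpha)\,x,$$ with $\alpha=\tfrac45$, $\beta=\tfrac12$, $k(y)=1$ for $y>0$ and $k(y)=0$ for $y<0$, with dynamics on $\{y=0\}$ given by Filippov's convention. Then there exists a homoclinic orbit through $x=x_0=\tfrac12$ on the line $y=0$, that is, a homoclinic orbit (to the boundary equilibrium $(\tfrac12,0)$) passing through the point $(\tfrac12,0)$.
   Context: For $\lambda\in[0,1]$ write $f(x,y;\lambda)=\bigl(1-x-\lambda x,\ \beta-\beta\varepsilon-\lambda\varepsilon-\alpha-(\beta+\lambda)y-(\alpha\beta-\alpha)x\bigr)$ with $\alpha=4/5$, $\beta=1/2$; equivalently $f(x,y;\lambda)=\bigl(1-(1+\lambda)x,\ -\tfrac{3}{10}+\tfrac25 x-(\tfrac12+\lambda)(y+\varepsilon)\bigr)$. The system is $(\dot x,\dot y)=f(x,y;k(y))$ for $y\neq 0$. A Filippov solution is an absolutely continuous curve $\gamma(t)=(x(t),y(t))$ with $\dot\gamma(t)\in F(\gamma(t))$ for almost every $t$, where $F(x,y)=\{f(x,y;k(y))\}$ if $y\ne0$ and $F(x,0)=\{f(x,0;\lambda):\lambda\in[0,1]\}$. Filippov solutions need not be unique forward in time. At $\varepsilon=-1/15$ the equilibrium of the smooth system $f(\cdot\,;1)$ is $p=(\tfrac12,0)$, which lies on the line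 $y=0$; it is called the boundary equilibrium. A homoclinic orbit (to $p$) is the orbit of a nonconstant Filippov solution $\gamma:\mathbb{R}\to\mathbb{R}^2$ with $\gamma(t)\to p$ both as $t\to+\infty$ and as $t\to-\infty$. It is allowed that $\gamma$ leaves $p$ in finite time, i.e. that $\gamma(t)=p$ for all $t\le t_0$ for some $t_0$. The orbit passes through $p$ if $\gamma(t_0)=p$ for some $t_0\in\mathbb{R}$. *)

(* Defs.v *)
From HB Require Import structures.
From mathcomp Require Import all_boot all_order all_algebra ring lra.
From mathcomp Require Import all_classical all_reals all_analysis.

Set Implicit Arguments.
Unset Strict Implicit.
Unset Printing Implicit Defensive.

Import Order.TTheory GRing.Theory Num.Theory.
Import numFieldNormedType.Exports.

Local Open Scope classical_set_scope.
Local Open Scope ring_scope.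

(* The switching function; its value at 0 plays no role, see [filippov]. *)
Definition switch (R : realType) (y : R) : R := if 0 < y then 1 else 0.

Definition vfield (R : realType) (alpha beta eps : R) (z : R * R) (lambda : R)
    : R * R :=
  (1 - z.1 - lambda * z.1,
   beta - beta * eps - lambda * eps - alpha - (beta + lambda) * z.2
     - (alpha * beta - alpha) * z.1).

Lemma boundary_equilibrium (R : realType) :
  @vfield R (4 / 5) (1 / 2) (- (1 / 15)) (1 / 2, 0) 1 = (0, 0).
Proof. by congr pair => /=; lra. Qed.

Definition filippov (R : realType) (alpha beta eps : R) (z : R * R)
    : set (R * R) :=
  if z.2 != 0 then [set vfield alpha beta eps z (switch z.2)]
  else [set vfield alpha beta eps z lambda | lambda in [set` `[0, 1]]].

(* Absolute continuity on [a, b]; the norm of R * R is the max norm. *)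
Definition abs_continuous_on (R : realType) (a b : R) (g : R -> R * R) : Prop :=
  forall e : R, 0 < e -> exists2 d : R, 0 < d &
    forall (n : nat) (u v : 'I_n -> R),
      (forall i, a <= u i /\ u i <= v i /\ v i <= b) ->
      trivIset setT (fun i => [set` `]u i, v i[]) ->
      \sum_(i < n) (v i - u i) < d ->
      \sum_(i < n) `|g (v i) - g (u i)| < e.

(* On the whole line, absolute continuity is meant on every compact interval. *)
Definition inclusion_solution (R : realType) (F : R * R -> set (R * R))
    (g : R -> R * R) : Prop :=
  (forall a b : R, abs_continuous_on a b g) /\
  {ae @lebesgue_measure R, forall t : R, derivable g t 1 /\ F (g t) (derive1 g t)}.

Definition homoclinic_orbit (R : realType) (F : R * R -> set (R * R))
    (p : R * R) (orb : set (R * R)) : Prop :=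
  exists g : R -> R * R,
    [/\ inclusion_solution F g,
        exists s t : R, g s <> g t,
        g t @[t --> +oo] --> p,
        g t @[t --> -oo] --> p
      & orb = range g].

(* Main.v *)
Require Import Defs.
From HB Require Import structures.
From mathcomp Require Import all_boot all_order all_algebra.
From mathcomp Require Import all_classical all_reals all_analysis.
From mathcomp Require Import ring lra.

Set Implicit Arguments.
Unset Strict Implicit.
Unset Printing Implicit Defensive.

Import Order.TTheory GRing.Theory Num.Theory.
Import numFieldNormedType.Exports.

Local Open Scope classical_set_scope.
Local Open Scope ring_scope.

(** The homoclinic orbit can be written down explicitly.

    At p = (1/2, 0) the upper field (lambda = 1) vanishes, so resting at p is
    a Filippov solution, while the lower field (lambda = 0) equals
    (1/2, -1/15) and points into y < 0.  A Filippov solution may therefore rest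
    at p until time 0 and then leave it along the lower flow.  Both fields are
    affine with triangular linear part, with eigenvalues -1, -1/2 below and
    -2, -3/2 above, so that in terms of e = exp(-t/2) their solutions are
    polynomials.  The lower solution that leaves p at t = 0, that is at e = 1,
    is
      x = 1 - e^2/2,  y = (2/5) (e - 1) (e - 2/3).
    It stays in y < 0 until e = 2/3, where it reaches y = 0 at (7/9, 0).  From
    there the upper solution is
      x = 1/2 + (45/32) e^4,  y = (3/4) e^3 (1 - (3/2) e),
    which stays in y > 0 and tends to p as e tends to 0.

    This trajectory is [profile] composed with [decay].  It satisfies the
    inclusion at every time but the two switching times e = 1 and e = 2/3
    ([trajectory_filippov]), and it is Lipschitz ([trajectory_lipschitz]),
    hence absolutely continuous. *)

(** * Two facts on planar curves *)

Lemma lipschitz_abs_continuous_on (R : realType) (L a b : R) (g : R -> R * R) :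
  (forall s t, s <= t -> `|g t - g s| <= L * (t - s)) ->
  abs_continuous_on a b g.
Proof.
move=> gL e e_gt0.
(* L may vanish or be negative; a positive constant is needed to divide e. *)
have M_gt0 : 0 < Num.max L 1 by rewrite lt_max ltr01 orbT.
exists (e / Num.max L 1); first by rewrite divr_gt0.
move=> n u v uv _; rewrite ltr_pdivlMr// mulrC mulr_sumr.
apply: le_lt_trans; apply: ler_sum => i _.
have [_ [le_uv _]] := uv i.
by rewrite (le_trans (gL _ _ le_uv))// ler_wpM2r ?subr_ge0// le_max lexx.
Qed.

Lemma is_derive_pair (R : realType) (U V : normedModType R) (f : R -> U)
    (g : R -> V) (t : R) (df : U) (dg : V) :
  is_derive t 1 f df -> is_derive t 1 g dg ->
  is_derive t 1 (fun u => (f u, g u)) (df, dg).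
Proof.
move=> [fd fE] [gd gE].
have dfg : (fun h => h^-1 *: (((fun u => (f u, g u)) \o shift t) (h *: (1 : R))
    - (f t, g t))) @ 0^' --> (df, dg).
  by apply: cvg_pair; rewrite -?fE -?gE.
by split; [apply/cvg_ex; exists (df, dg) | exact: cvg_lim].
Qed.

Section HomoclinicTrajectory.
Variable R : realType.
Implicit Types (t e : R).

(** * The exponential clock *)

(** The rate 1/2 makes every exponential occurring in either flow an integral
    power of [decay]. *)
Definition decay t := expR (- (t / 2)).

Lemma decay_gt0 t : 0 < decay t. Proof. exact: expR_gt0. Qed.

Lemma decay_level c t : decay t = c -> t = - (2 * ln c).
Proof. by move=> <-; rewrite /decay expRK; lra. Qed.

Lemma cvg_decay : decay t @[t --> +oo] --> 0.
Proof.
apply: (@cvg_comp _ _ _ (fun t => t / 2) (fun t => expR (- t)) _ +oo).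
  by apply: gt0_cvgMly; [lra|exact: cvg_id].
exact: cvgr_expR.
Qed.

Lemma continuous_decay : continuous decay.
Proof.
move=> t; apply: continuous_comp; last exact: continuous_expR.
by apply: continuousN; apply: (@mulrr_continuous R).
Qed.

(** A constant and two modes are enough: each coordinate of each piece of the
    trajectory has this form. *)
Lemma is_derive_decay_modes (c a b : R) (m n : nat) t :
  is_derive t 1 (fun u => c + a * decay u ^+ m + b * decay u ^+ n)
    (- (m%:R / 2 * a * decay t ^+ m + n%:R / 2 * b * decay t ^+ n)).
Proof.
have mode (k : nat) : is_derive t 1 (fun u => decay u ^+ k)
    (- (k%:R / 2 * decay t ^+ k)).
  have -> : (fun u => decay u ^+ k) = expR \o (fun u => (- (k%:R / 2)) *: u).
    apply/funext => u; rewrite /decay /= -expRM_natl; congr expR.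
    by rewrite /GRing.scale/=; field.
  apply: is_derive_eq.
  rewrite /decay -expRM_natl /GRing.scale/=.
  have -> : - (k%:R / 2) * t = k%:R * - (t / 2) by field.
  ring.
apply: is_derive_eq; rewrite /GRing.scale/=; ring.
Qed.

(** * The trajectory *)

(** The three pieces in a single formula: [s] runs along the lower arc and
    stops at 2/3, after which [r], equal to 1 until then, runs along the upper
    arc.  A polynomial in these clamped parameters is Lipschitz in time
    without any gluing argument, even though [decay] is not. *)
Definition profile e : R * R :=
  let s := Num.max (2 / 3) (Num.min 1 e) in
  let r := Num.min 1 (3 / 2 * e) in
  (1 / 2 + (1 - s ^+ 2) / 2 + 5 / 18 * (r ^+ 4 - 1),
   2 / 5 * (s - 1) * (s - 2 / 3) + 2 / 9 * (r ^+ 3 - r ^+ 4)).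

Lemma profile_rest e : 1 <= e -> profile e = (1 / 2, 0).
Proof.
move=> e1; rewrite /profile.
have -> : Num.min 1 e = 1 by apply/min_idPl.
have -> : Num.max (2 / 3) 1 = 1 :> R by apply/max_idPr; lra.
have -> : Num.min 1 (3 / 2 * e) = 1 by apply/min_idPl; lra.
by congr pair; field.
Qed.

Lemma profile_below e : 2 / 3 <= e <= 1 ->
  profile e = (1 - 1 / 2 * e ^+ 2, 2 / 5 * (e - 1) * (e - 2 / 3)).
Proof.
move=> /andP[e23 e1]; rewrite /profile.
have -> : Num.min 1 e = e by apply/min_idPr.
have -> : Num.max (2 / 3) e = e :> R by apply/max_idPr.
have -> : Num.min 1 (3 / 2 * e) = 1 by apply/min_idPl; lra.
by congr pair; field.
Qed.

Lemma profile_above e : e <= 2 / 3 ->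
  profile e = (1 / 2 + 45 / 32 * e ^+ 4, 3 / 4 * e ^+ 3 * (1 - 3 / 2 * e)).
Proof.
move=> e23; rewrite /profile.
have -> : Num.min 1 e = e by apply/min_idPr; lra.
have -> : Num.max (2 / 3) e = 2 / 3 :> R by apply/max_idPl.
have -> : Num.min 1 (3 / 2 * e) = 3 / 2 * e by apply/min_idPr; lra.
by congr pair; field.
Qed.

Definition trajectory t := profile (decay t).

(** * Lipschitz continuity *)

Lemma exprn_unit_contract (x y : R) (n : nat) : 0 <= y -> y <= x -> x <= 1 ->
  0 <= x ^+ n - y ^+ n <= n%:R * (x - y).
Proof.
move=> y0 yx x1; elim: n => [|n /andP[IH1 IH2]]; first by rewrite !expr0; lra.
have yn0 := exprn_ge0 n y0.
have xn1 : x ^+ n <= 1 by apply: exprn_ile1; lra.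
rewrite !exprS -[n.+1]addn1 natrD; nra.
Qed.

(** Where [c * decay] is at most 1 its slope is at most 1/2 in absolute value,
    and elsewhere it is clamped. *)
Lemma decay_clip_contract (c s t : R) : 0 < c -> s <= t ->
  0 <= Num.min 1 (c * decay s) - Num.min 1 (c * decay t) <= (t - s) / 2.
Proof.
move=> c0 st.
have ds := decay_gt0 s; have dt := decay_gt0 t.
have dts : decay t <= decay s by rewrite ler_expR; lra.
(* Convexity of exp replaces the mean value theorem: 1 + x <= exp x. *)
have dE : decay s * (1 - (t - s) / 2) <= decay t.
  have -> : decay t = decay s * expR (- ((t - s) / 2)).
    by rewrite /decay -expRD; congr expR; field.
  by rewrite ler_pM2l// expR_ge1Dx.
have [u0 v0] : 0 < c * decay s /\ 0 < c * decay t by split; nra.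
have vu : c * decay t <= c * decay s by nra.
have uv : c * decay s * (1 - (t - s) / 2) <= c * decay t.
  by rewrite -mulrA ler_pM2l.
move: {dE ds dt dts} (c * decay s) (c * decay t) u0 v0 vu uv => u v u0 v0 vu uv.
case: (leP 1 u) => hu; case: (leP 1 v) => hv; apply/andP; split; nra.
Qed.

Lemma trajectory_lipschitz s t :
  s <= t -> `|trajectory t - trajectory s| <= 3 * (t - s).
Proof.
move=> st; rewrite /trajectory /profile.
have clip01 c u : 0 < c -> 0 <= Num.min 1 (c * decay u) <= 1.
  move=> c0; rewrite ge_min lexx le_min ler01 andbT/=.
  by rewrite mulr_ge0// ltW// decay_gt0.
have c32 : 0 < 3 / 2 :> R by lra.
have := @decay_clip_contract 1 s t ltr01 st.
have := @decay_clip_contract (3 / 2) s t c32 st.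
have := clip01 _ s c32; have := clip01 _ t c32.
have := clip01 _ s ltr01; have := clip01 _ t ltr01; rewrite !mul1r.
set p := Num.min 1 (decay s); set q := Num.min 1 (decay t).
set r := Num.min 1 (3 / 2 * decay s); set r' := Num.min 1 (3 / 2 * decay t).
move=> /andP[q0 q1] /andP[p0 p1] /andP[r'0 r'1] /andP[r0 r1].
move=> /andP[rr' rL] /andP[pq pL].
set a := Num.max (2 / 3) p; set b := Num.max (2 / 3) q.
have [a1 b0 ab abL] : [/\ a <= 1, 0 <= b, b <= a & a - b <= (t - s) / 2].
  rewrite /a /b.
  by case: (leP (2 / 3) p) => ?; case: (leP (2 / 3) q) => ?; split; lra.
have rr : r' <= r by lra.
have /andP[A0 A1] := @exprn_unit_contract a b 2 b0 ab a1.
have /andP[B0 B1] := @exprn_unit_contract r r' 3 r'0 rr r1.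
have /andP[C0 C1] := @exprn_unit_contract r r' 4 r'0 rr r1.
rewrite prod_normE/= ge_max !ler_norml.
apply/andP; split; apply/andP; split; lra.
Qed.

(** * The differential inclusion *)

(** Off the two switching times the trajectory lies locally in one piece, whose
    second coordinate is positive, negative or identically zero.  In the last
    case the trajectory rests at p, and its velocity 0 is the value of the
    convexified field at lambda = 1. *)
Lemma trajectory_filippov t : decay t != 1 -> decay t != 2 / 3 ->
  exists2 v, is_derive t 1 trajectory v &
    filippov (4 / 5) (1 / 2) (- (1 / 15)) (trajectory t) v.
Proof.
move=> d1 d23; have d0 := decay_gt0 t.
have near_lt c : decay t < c -> \near t, decay t < c.
  by move=> h; apply: (cvgr_lt (decay t) (continuous_decay (x:=t))) h.
have near_gt c : c < decay t -> \near t, c < decay t.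
  by move=> h; apply: (cvgr_gt (decay t) (continuous_decay (x:=t))) h.
have [dlt1|dgt1|dE] := ltgtP (decay t) 1; last by rewrite dE eqxx in d1.
  have [dlt|dgt|dE] := ltgtP (decay t) (2 / 3); last by rewrite dE eqxx in d23.
  - have dpiece := is_derive_pair
      (is_derive_decay_modes (1 / 2) (45 / 32) 0 4 0 t)
      (is_derive_decay_modes 0 (3 / 4) (- (9 / 8)) 3 4 t).
    eexists.
      apply: near_eq_is_derive dpiece.
      near=> u; rewrite /trajectory profile_above.
        by rewrite /=; congr pair; field.
      by rewrite ltW//; near: u; exact: near_lt.
    rewrite /trajectory profile_above ?ltW// /filippov /switch/=.
    have y0 : 0 < 3 / 4 * decay t ^+ 3 * (1 - 3 / 2 * decay t).
      have := exprn_gt0 3 d0; nra.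
    by rewrite (gt_eqF y0)/= y0 /vfield/=; congr pair; field.
  - have dpiece := is_derive_pair
      (is_derive_decay_modes 1 (- (1 / 2)) 0 2 0 t)
      (is_derive_decay_modes (4 / 15) (- (2 / 3)) (2 / 5) 1 2 t).
    eexists.
      apply: near_eq_is_derive dpiece.
      near=> u; rewrite /trajectory profile_below.
        by rewrite /=; congr pair; field.
      by apply/andP; split; rewrite ltW//; near: u;
        [exact: near_gt|exact: near_lt].
    rewrite /trajectory profile_below ?ltW// /filippov /switch/=.
    have y0 : 2 / 5 * (decay t - 1) * (decay t - 2 / 3) < 0 by nra.
    rewrite (lt_eqF y0)/= [0 < _]ltNge (ltW y0) /vfield/=.
    by congr pair; field.
exists (0, 0).
  apply: near_eq_is_derive (is_derive_cst (1 / 2 : R, 0 : R) t 1).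
  by near=> u; rewrite /trajectory profile_rest//= ltW//; near: u;
    exact: near_gt.
rewrite /trajectory profile_rest ?ltW// /filippov/= eqxx/=.
exists 1; last exact: boundary_equilibrium.
by rewrite /= in_itv/= ler01 lexx.
Unshelve. all: by end_near. Qed.

Lemma trajectory_solution :
  inclusion_solution (filippov (4 / 5) (1 / 2) (- (1 / 15))) trajectory.
Proof.
split.
  by move=> a b; apply: lipschitz_abs_continuous_on trajectory_lipschitz.
exists [set - (2 * ln 1); - (2 * ln (2 / 3))]; split.
- by apply: measurableU; exact: measurable_set1.
- apply: countable_lebesgue_measure0; apply: finite_set_countable.
  exact: finite_set2.
- move=> t /= nsol; apply: contrapT => /not_orP[t1 t23]; apply: nsol.
  have [||v [dv vE] vF] := @trajectory_filippov t.
  + by apply/eqP => /decay_level.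
  + by apply/eqP => /decay_level.
  + by split; rewrite ?derive1E ?vE.
Qed.

(** * Limits at infinity *)

Lemma trajectory_cvg_ninfty : trajectory t @[t --> -oo] --> (1 / 2 : R, 0 : R).
Proof.
apply: cvg_near_cst; near=> t.
rewrite /trajectory profile_rest// -expR0 ler_expR.
have : t <= 0 by near: t; apply: nbhs_ninfty_le.
lra.
Unshelve. all: by end_near. Qed.

Lemma trajectory_cvg_pinfty : trajectory t @[t --> +oo] --> (1 / 2 : R, 0 : R).
Proof.
pose above e : R * R :=
  (1 / 2 + 45 / 32 * e ^+ 4, 3 / 4 * e ^+ 3 * (1 - 3 / 2 * e)).
have above_near : \forall t \near +oo, above (decay t) = trajectory t.
  near=> t; rewrite /trajectory profile_above// ltW//.
  by near: t; apply: (cvgr_lt 0 cvg_decay); lra.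
apply: cvg_trans (near_eq_cvg above_near) _.
have mode n : decay t ^+ n.+1 @[t --> +oo] --> (0 : R).
  have := cvg_comp _ _ cvg_decay (@exprn_continuous R n.+1 0).
  by rewrite expr0n.
have x_cvg : 1 / 2 + 45 / 32 * decay t ^+ 4 @[t --> +oo] --> (1 / 2 : R).
  rewrite [X in _ --> X](_ : _ = 1 / 2 + 45 / 32 * 0); last by ring.
  by apply: cvgD; [exact: cvg_cst|apply: cvgM; [exact: cvg_cst|exact: mode]].
have y_cvg : 3 / 4 * decay t ^+ 3 * (1 - 3 / 2 * decay t) @[t --> +oo]
    --> (0 : R).
  rewrite [X in _ --> X](_ : _ = 3 / 4 * 0 * (1 - 3 / 2 * 0)); last by ring.
  apply: cvgM; first by apply: cvgM; [exact: cvg_cst|exact: mode].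
  apply: cvgB; first exact: cvg_cst.
  by apply: cvgM; [exact: cvg_cst|exact: cvg_decay].
exact: cvg_pair x_cvg y_cvg.
Unshelve. all: by end_near. Qed.

End HomoclinicTrajectory.

(** * The homoclinic orbit *)

Theorem theorem4 (R : realType) :
  exists orb : set (R * R),
    homoclinic_orbit (filippov (4 / 5) (1 / 2) (- (1 / 15))) (1 / 2, 0) orb /\
    orb (1 / 2, 0).
Proof.
have trajectory0 : trajectory (0 : R) = (1 / 2, 0).
  by rewrite /trajectory /decay mul0r oppr0 expR0 profile_rest.
exists (range (@trajectory R)); split; last by exists 0.
exists (@trajectory R); split=> //.
- exact: trajectory_solution.
- (* Any time on the upper arc serves; this one has [decay] equal to 1/3. *)
  exists 0, (- (2 * ln (1 / 3))); rewrite trajectory0 /trajectory.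
  have -> : decay (- (2 * ln (1 / 3)) : R) = 1 / 3.
    rewrite /decay (_ : - _ = ln (1 / 3)); last by field.
    by rewrite lnK// posrE; lra.
  rewrite profile_above; last lra.
  by move=> [] /eqP; lra.
- exact: trajectory_cvg_pinfty.
- exact: trajectory_cvg_ninfty.
Qed.
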